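(* Let $S$ be a semigroup and let $e$ be a central element of $S$ (i.e. $es=se$ for all $s\in S$). If there exists $a\in S$ such that $ae\neq a$, then $S$ is not an equational domain in the language $\mathcal{L}_S$.
   Context: For a semigroup $S$, an $\mathcal{L}_S$-term in variables $x_1,\dots,x_n$ is a finite nonempty product of variables and constants from $S$. An equation over $\mathcal{L}_S$ is an equality of two $\mathcal{L}_S$-terms; a system is an arbitrary set of equations. A set $Y\subseteq S^n$ is algebraic over $\mathcal{L}_S$ if it is the set of all solutions in $S^n$ of some system over $\mathcal{L}_S$ in variables $x_1,\dots,x_n$. $S$ is an equational domain in $\mathcal{L}_S$ if for any $n$ and any finite collection of algebraic sets $Y_1,\dots,Y_k\subseteq S^n$ ($k\ge 1$) over $\mathcal{L}_S$ the union $Y_1\cup\dots\cup Y_k$ is algebraic over $\mathcal{L}_S$. *)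

(* Defs.v *)
From HB Require Import structures.
From mathcomp Require Import all_boot.
From mathcomp Require Import boolp classical_sets.

Set Implicit Arguments.
Unset Strict Implicit.
Unset Printing Implicit Defensive.

Local Open Scope group_scope.
Local Open Scope classical_set_scope.

Section Equations.
Variables (S : semigroupType) (n : nat).

Notation point := {ffun 'I_n -> S}.

Inductive letter := Var of 'I_n | Const of S.

(* [Term l w] is the product of the letters of l :: w; the first letter is kept
   apart because a semigroup need not have a unit. *)
Inductive term := Term of letter & seq letter.

Definition eval_letter (p : point) (l : letter) : S :=
  match l with Var i => p i | Const s => s end.

Definition eval (p : point) (t : term) : S :=
  let: Term l w := t in
  foldl (fun x l' => x * eval_letter p l') (eval_letter p l) w.

Inductive equation := Equation of term & term.

Definition satisfies (p : point) (E : equation) : Prop :=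
  let: Equation t u := E in eval p t = eval p u.

Definition solutions (sys : set equation) : set point :=
  [set p | forall E, sys E -> satisfies p E].

Definition algebraic (Y : set point) : Prop :=
  exists sys : set equation, Y = solutions sys.

End Equations.

Definition equational_domain (S : semigroupType) : Prop :=
  forall (n k : nat) (Y : 'I_k -> set {ffun 'I_n -> S}),
    (0 < k)%N -> (forall i, algebraic (Y i)) -> algebraic (\bigcup_i Y i).

Definition central (S : semigroupType) (e : S) : Prop :=
  forall s : S, commute e s.

(* Main.v *)
Require Import Defs.
From mathcomp Require Import all_boot.
From mathcomp Require Import boolp classical_sets.

(** Multiplying one coordinate of a point by a central element [e] multiplies
    the value of a term by a power of [e], whose exponent (the number of
    occurrences of that variable) depends only on the term.  All powers of [e]
    commute, so if an equation holds at [p] and still holds after multiplying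
    coordinate [i] by [e], and after multiplying coordinate [j] by [e], then it
    holds after doing both ([satisfies_scale2]).

    Now let [a * e <> a] and consider, in the plane, the union of the two lines
    [x_0 = a] and [x_1 = a].  It contains [(a, a)], [(a * e, a)] and
    [(a, a * e)], so every algebraic set containing it also contains
    [(a * e, a * e)], which lies on neither line. *)

Local Open Scope group_scope.
Local Open Scope classical_set_scope.

Section CentralScaling.
Context {S : semigroupType} (e : S).

(** Powers of [e] appear as iterates of right multiplication, since a semigroup
    need not have an element [e ^+ 0]. *)
Definition mul_pow (k : nat) (x : S) : S := iter k (fun y => y * e) x.

Lemma mul_powD k l x : mul_pow (k + l) x = mul_pow k (mul_pow l x).
Proof. exact: iterD. Qed.

Lemma mul_powC k l x : mul_pow k (mul_pow l x) = mul_pow l (mul_pow k x).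
Proof. by rewrite -!mul_powD addnC. Qed.

Lemma mul_mul_pow k x y : x * mul_pow k y = mul_pow k (x * y).
Proof. by elim: k => //= k <-; rewrite mulgA. Qed.

Lemma mul_pow_mul k x y : central e -> mul_pow k x * y = mul_pow k (x * y).
Proof. by move=> he; elim: k => //= k <-; rewrite -mulgA he mulgA. Qed.

Definition scale {n} (i : 'I_n) (p : {ffun 'I_n -> S}) : {ffun 'I_n -> S} :=
  [ffun j => if j == i then p j * e else p j].

Lemma eval_letter_scale {n} (i : 'I_n) (l : letter S n) :
  exists k, forall p, eval_letter (scale i p) l = mul_pow k (eval_letter p l).
Proof.
by case: l => [j|s]; [exists (j == i : nat) => p /=; rewrite ffunE; case: eqP
                     | exists 0].
Qed.

Lemma eval_rcons {n} (p : {ffun 'I_n -> S}) l w (l' : letter S n) :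
  eval p (Term l (rcons w l')) = eval p (Term l w) * eval_letter p l'.
Proof. by rewrite /eval foldl_rcons. Qed.

(** The exponent [k] is chosen before the point [p]: this uniformity is what
    allows exponents found at different points to be combined. *)
Lemma eval_scale {n} (i : 'I_n) (t : term S n) : central e ->
  exists k, forall p, eval (scale i p) t = mul_pow k (eval p t).
Proof.
move=> he; case: t => l w; elim/last_ind: w => [|w l' [k IH]].
  exact: eval_letter_scale.
have [k' Hk'] := eval_letter_scale i l'.
exists (k' + k) => p.
by rewrite !eval_rcons IH Hk' mul_mul_pow mul_pow_mul // mul_powD.
Qed.

(** With [T] the common value of both sides at [p], the hypotheses read
    [T e^k = T e^k'] and [T e^l = T e^l']; hence
    [T e^k e^l = T e^k' e^l = T e^l e^k' = T e^l' e^k']. *)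
Lemma satisfies_scale2 {n} (i j : 'I_n) (p : {ffun 'I_n -> S})
    (E : equation S n) : central e ->
  satisfies p E -> satisfies (scale i p) E -> satisfies (scale j p) E ->
  satisfies (scale i (scale j p)) E.
Proof.
move=> he; case: E => t u /= Hp.
have [k tk] := eval_scale i t he; have [k' uk'] := eval_scale i u he.
have [l tl] := eval_scale j t he; have [l' ul'] := eval_scale j u he.
rewrite !tk !uk' !tl !ul' -Hp => Hi Hj.
by rewrite mul_powC Hi mul_powC Hj.
Qed.

End CentralScaling.

Lemma algebraic_coord {S : semigroupType} {n} (i : 'I_n) (a : S) :
  algebraic [set p : {ffun 'I_n -> S} | p i = a].
Proof.
exists [set Equation (Term (Var S i) [::]) (Term (Const n a) [::])].
apply/seteqP; split => p /=; first by move=> pi E ->.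
by move/(_ _ erefl).
Qed.

Theorem theorem6p2 (S : semigroupType) (e : S) (he : central e)
    (ha : exists a : S, a * e <> a) : ~ equational_domain S.
Proof.
case: ha => a ae_neq_a domS.
pose line (i : 'I_2) := [set p : {ffun 'I_2 -> S} | p i = a].
have [sys lines_sys] := domS 2 2 line isT (fun i => algebraic_coord i a).
pose p : {ffun 'I_2 -> S} := [ffun=> a].
have on_lines (q : {ffun 'I_2 -> S}) i : q i = a -> solutions sys q.
  by rewrite -lines_sys; exists i.
have corner : solutions sys (scale e ord0 (scale e ord_max p)).
  move=> E sysE; apply: satisfies_scale2 => //.
  - by apply: (on_lines p ord0) => //; rewrite ffunE.
  - by apply: (on_lines _ ord_max) => //; rewrite !ffunE.
  - by apply: (on_lines _ ord0) => //; rewrite !ffunE.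
move: corner; rewrite -lines_sys => -[i _]; rewrite /line /= !ffunE.
by case: i => -[|[|]].
Qed.
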